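(* For odd $k$ and $\ell=\lceil k/2\rceil$, the number of I-matchings of $X_{2k}$ of size $k$ is $\frac{1}{\ell}\binom{4\ell-2}{\ell-1}$.
   Context: Let $k\ge 1$ and let $X_{2k}=\{P_1,\dots,P_{2k}\}$ be $2k$ points in convex position in the plane, labeled in clockwise cyclic order; indices are taken modulo $2k$. A matching of $X_{2k}$ means a set of $k$ pairwise non-crossing straight segments (edges) with endpoints in $X_{2k}$ covering every point exactly once; its size is $k$. Matchings with different labels are counted as different. A block of a matching $M$ is a pair of edges $\{P_iP_{i+3},P_{i+1}P_{i+2}\}\subseteq M$. If $K$ is a block of a matching $N$ of size $k+2$, then $N-K$ denotes the set $N\setminus K$, regarded as a matching of the remaining $2k$ points (which are in convex position) with their inherited cyclic order, i.e. as a matching of size $k$ defined up to cyclic relabeling. I-matchings are defined recursively: the unique matching of size $1$ is an I-matching; for odd $k\ge 3$, a matching $N$ of size $k$ is an I-matching iff it has a block $K$ such that $N-K$ is an I-matching (this notion is invariant under cyclic relabeling). *)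

(* Defs.v *)
From mathcomp Require Import all_boot.
Set Implicit Arguments. Unset Strict Implicit. Unset Printing Implicit Defensive.

(* The 2k points P_1..P_{2k} in clockwise order are modelled by 'I_n
   (point j <-> label j, cyclic order = numeric order mod n).
   An edge is a 2-element subset of the points; a matching is a set of edges. *)

(* Two segments {a,b}, {c,d} between points in convex position cross
   iff their endpoints interleave along the cyclic order. *)
Definition crossing (n : nat) (e1 e2 : {set 'I_n}) : bool :=
  [exists a : 'I_n, exists b : 'I_n, exists c : 'I_n, exists d : 'I_n,
     [&& e1 == [set a; b], e2 == [set c; d], a < c, c < b & b < d]].

Definition is_matching (n : nat) (M : {set {set 'I_n}}) : bool :=
  [&& partition M [set: 'I_n],
      [forall e in M, #|e| == 2] &
      [forall e1 in M, forall e2 in M, ~~ crossing e1 e2]].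

Definition pt (n : nat) (j : nat) : 'I_n.+1 := inord (j %% n.+1).

Definition block_edge1 (n : nat) (i : 'I_n.+4) : {set 'I_n.+4} :=
  [set pt n.+3 i; pt n.+3 (i + 3)].
Definition block_edge2 (n : nat) (i : 'I_n.+4) : {set 'I_n.+4} :=
  [set pt n.+3 (i + 1); pt n.+3 (i + 2)].

Definition is_block (n : nat) (i : 'I_n.+4) (M : {set {set 'I_n.+4}}) : bool :=
  (block_edge1 i \in M) && (block_edge2 i \in M).

(* Relabelling of the remaining points i+4, i+5, ..., i+n+3 (mod n+4),
   in inherited cyclic order, as 0, 1, ..., n-1. *)
Definition relabel (n : nat) (i : 'I_n.+4) (j : 'I_n) : 'I_n.+4 :=
  pt n.+3 (i + 4 + j).

Definition remove_block (n : nat) (i : 'I_n.+4) (M : {set {set 'I_n.+4}})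
  : {set {set 'I_n}} :=
  [set [set j | relabel i j \in e] | e : {set 'I_n.+4} in (M :\ block_edge1 i :\ block_edge2 i)].

Fixpoint isI (n : nat) : {set {set 'I_n}} -> bool :=
  match n return {set {set 'I_n}} -> bool with
  | 2 => fun M => is_matching M
  | m.+4 => fun M =>
      [&& odd (m.+4)./2, is_matching M &
          [exists i : 'I_m.+4, is_block i M && isI (remove_block i M)]]
  | _ => fun _ => false
  end.

(* Main.v *)
Require Import Defs.
From HB Require Import structures.
From mathcomp Require Import all_boot zify.
Set Implicit Arguments. Unset Strict Implicit. Unset Printing Implicit Defensive.

(** In the plane tree dual to a matching, removing a block removes a pendant path with two edges,
    so the I-matchings are dual to the plane trees with a perfect matching. Call an edge inner
    if it is dual to an edge of that perfect matching, and outer otherwise. Read from a fixed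
    point, such a matching is a word [S b S c S] with [S ::= empty | a S b S c S d S], where
    a, d are the ends of an outer edge and b, c those of an inner one. Hence it is encoded by
    three quaternary trees. This class of words is stable under rotation, and every word longer
    than [b c] has a rotation starting with the block [a b c d]. Outer arcs have length 3
    modulo 4 and inner arcs length 1, so the matching determines its word. Forests of [r]
    quaternary trees with [n] nodes satisfy [t n.+1 r.+1 = t n.+1 r + t n r.+4], whence
    [t n r = r / (4n + r) * 'C(4n + r, n)]. *)

(** * Quaternary trees and their number *)

Inductive qtree := Leaf | Node of qtree & qtree & qtree & qtree.

Lemma qtree_eq_dec : forall s t : qtree, decidable (s = t).
Proof. by rewrite /decidable; decide equality. Qed.

HB.instance Definition _ := hasDecEq.Build qtree (compareP qtree_eq_dec).

Fixpoint nodes (s : qtree) : nat :=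
  if s is Node a b c d then (nodes a + nodes b + nodes c + nodes d).+1 else 0.

Definition forest_nodes (f : seq qtree) : nat := sumn (map nodes f).

(** The recursion is lexicographic in [(n, r)], hence the nested [fix]. A first tree that is a leaf
    is dropped. Otherwise its root is cut off, which leaves [r'.+4] trees with one node fewer. The
    branch [else f] is never taken, since these forests have at least four trees. *)
Fixpoint forests (n : nat) : nat -> seq (seq qtree) :=
  fix forests_n (r : nat) : seq (seq qtree) :=
    match r with
    | 0 => if n is 0 then [:: [::]] else [::]
    | r'.+1 => map (cons Leaf) (forests_n r') ++
        (if n is n'.+1 then
           [seq (if f is a :: b :: c :: d :: f' then Node a b c d :: f' else f)
              | f <- forests n' r'.+4]
         else [::])
    end.

Lemma forestsS n r : forests n.+1 r.+1 = map (cons Leaf) (forests n.+1 r) ++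
  [seq (if f is a :: b :: c :: d :: f' then Node a b c d :: f' else f)
     | f <- forests n r.+4].
Proof. by []. Qed.

Lemma mem_forests n r f :
  (f \in forests n r) = (size f == r) && (forest_nodes f == n).
Proof.
rewrite /forest_nodes.
elim: n r f => [|n IHn]; elim=> [|r IHr] f.
- by case: f.
- rewrite /= cats0; case: f => [|s f] /=.
    by apply/negP=> /mapP[].
  apply/mapP/idP => [[g + [-> ->]]|].
    by rewrite IHr /= eqSS.
  case: s => [|a b c d] /=; last by rewrite addSn andbF.
  by move=> H; exists f => //; rewrite IHr -eqSS.
- by case: f.
- rewrite forestsS mem_cat; case: f => [|s f].
    apply/norP; split; apply/mapP => -[] // g.
    by rewrite IHn; case: g => [|a [|b [|c [|d g]]]].
  apply/orP/idP => [[] /mapP[g]|].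
  + by rewrite IHr => + [-> ->] /=; rewrite eqSS.
  + rewrite IHn; case: g => [|a [|b [|c [|d g]]]] //= + [-> ->].
    by rewrite /= => /andP[/eqP[] <- /eqP <-]; apply/andP; split; apply/eqP; lia.
  + case: s => [|a b c d] /= /andP[/eqP [sf] /eqP nf].
      by left; apply/mapP; exists f => //; rewrite IHr sf -nf /= !eqxx.
    right; apply/mapP; exists [:: a, b, c, d & f] => //.
    by rewrite IHn /= sf eqxx; apply/eqP; lia.
Qed.

Lemma forests_uniq n r : uniq (forests n r).
Proof.
elim: n r => [|n IHn]; elim=> [|r IHr] //.
  by rewrite /= cats0 map_inj_uniq // => f g [].
rewrite forestsS cat_uniq map_inj_uniq ?IHr => [|f g []//]; apply/and3P; split=> //.
  apply/hasPn => f /mapP[g]; rewrite mem_forests.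
  by case: g => [|a [|b [|c [|d g]]]] //= _ ->; apply/mapP=> -[].
rewrite map_inj_in_uniq // => f g; rewrite !mem_forests.
by case: f g => [|? [|? [|? [|? f]]]] // [|? [|? [|? [|? g]]]] //= _ _ [-> -> -> -> ->].
Qed.

(** Both smaller counts in the recursion have the same total [N = 4 * n + r.+4]. They therefore
    combine through Pascal's rule and the ratio of 'C(N, n.+1) to 'C(N, n). *)
Lemma size_forests n r : size (forests n r) * (4 * n + r) = r * 'C(4 * n + r, n).
Proof.
elim: n r => [|n IHn].
  have size1 r : size (forests 0 r) = 1 by elim: r => //= r; rewrite cats0 size_map.
  by move=> r; rewrite size1 bin0; lia.
elim=> [|r IHr]; first by rewrite mul0n.
rewrite forestsS size_cat !size_map.
move: IHr (IHn r.+4).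
set u := size _; set v := size _.
have -> : 4 * n.+1 + r.+1 = (4 * n + r.+4).+1 by lia.
have -> : 4 * n.+1 + r = 4 * n + r.+4 by lia.
set N := 4 * n + r.+4; rewrite binS.
have := mul_bin_left N n.
have -> : N - n = 3 * n + r.+4 by lia.
(* The induction hypotheses know [u] and [v] only after multiplication by [N], so the goal is
   multiplied by the positive [N]. *)
move=> E1 E2 E3; apply/eqP; rewrite -(eqn_pmul2l (_ : 0 < N)) ?/N; last lia.
apply/eqP; rewrite -/N.
have -> : N * ((u + v) * N.+1) = N.+1 * (u * N + v * N) by nia.
rewrite E2 E3; move: E1; set c1 := 'C(_, n.+1); set c0 := 'C(_, n) => E1.
rewrite /N; nia.
Qed.

Lemma size_forests3 n : n.+1 * size (forests n 3) = 'C(4 * n + 2, n).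
Proof.
have E := size_forests n 3.
have := mul_bin_down (4 * n + 3) n; rewrite (addnS _ 2) /= -addnS.
have -> : 4 * n + 3 - n = 3 * n.+1 by lia.
set a := 'C(_, n) in E *; set b := 'C(_, n) => E'.
have pos : 0 < 4 * n + 3 by lia.
apply/eqP; rewrite -(eqn_pmul2l pos); apply/eqP.
by rewrite E' (mulnC 3) -(mulnA _ 3) -E; lia.
Qed.

(** * Words and arcs of a tree *)

(* The letter a is [true]; b, c and d are all [false]. *)
Fixpoint code (s : qtree) : seq bool :=
  if s is Node a b c d then
    true :: code a ++ false :: code b ++ false :: code c ++ false :: code d
  else [::].

(** The [false] added after each tree stands for its last leaf. The result is the preorder
    (Łukasiewicz) word: [true] for a node, [false] for a leaf. *)
Definition fcode (f : seq qtree) : seq bool :=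
  flatten [seq code s ++ [:: false] | s <- f].

Lemma fcode_Node a b c d f :
  fcode (Node a b c d :: f) = true :: fcode [:: a, b, c, d & f].
Proof. by rewrite /fcode /= -!catA /= -!catA /= -!catA. Qed.

Lemma fcode_Leaf f : fcode (Leaf :: f) = false :: fcode f.
Proof. by []. Qed.

(** The first letter tells whether the first tree is a leaf or a node. Removing it leaves the word
    of a forest in which that leaf is deleted or that node replaced by its four children. *)
Lemma fcode_inj f g : size f = size g -> fcode f = fcode g -> f = g.
Proof.
move: {2}(fcode g) (erefl (fcode g)) => w Eg sfg Ef.
have {Ef} : fcode f = w by rewrite Ef.
elim: w f g Eg sfg => [|b w IHw] f g.
  by case: f g => [|[|????] ?] [|[|????] ?].
case: f g => [|s f] [|t g] //.
case: s t => [|a1 a2 a3 a4] [|b1 b2 b3 b4].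
- by rewrite !fcode_Leaf => -[_ Eg] [sfg] [_ Ef]; rewrite (IHw _ _ Eg sfg Ef).
- by rewrite fcode_Leaf fcode_Node => -[<- _] _ [].
- by rewrite fcode_Leaf fcode_Node => -[<- _] _ [].
- rewrite !fcode_Node => -[_ Eg] [sfg] [_ Ef].
  have := IHw _ _ Eg _ Ef; rewrite /= sfg => /(_ erefl).
  by move=> [-> -> -> -> ->].
Qed.

(* Number of points covered by [s]. *)
Definition len (s : qtree) : nat := 4 * nodes s.

Lemma len_Node a b c d : len (Node a b c d) = len a + len b + len c + len d + 4.
Proof. rewrite /len /=; lia. Qed.

Lemma size_code s : size (code s) = len s.
Proof.
elim: s => // a IHa b IHb c IHc d IHd.
by rewrite len_Node /=; do !rewrite size_cat /=; rewrite IHa IHb IHc IHd; lia.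
Qed.

(** The letters a, b, c, d of the root stand at [o], [pb], [pc], [pd]; its outer arc is listed
    first, then its inner arc. *)
Fixpoint arcs (s : qtree) (o : nat) : seq (nat * nat) :=
  if s is Node a b c d then
    let pb := o.+1 + len a in let pc := pb.+1 + len b in let pd := pc.+1 + len c in
    [:: (o, pd), (pb, pc) & arcs a o.+1 ++ arcs b pb.+1 ++ arcs c pc.+1 ++ arcs d pd.+1]
  else [::].

Definition arcs3 (x y z : qtree) (o : nat) : seq (nat * nat) :=
  let pb := o + len x in let pc := pb.+1 + len y in
  (pb, pc) :: arcs x o ++ arcs y pb.+1 ++ arcs z pc.+1.

Definition len3 (x y z : qtree) : nat := len x + len y + len z + 2.

(** Regroups a S b S c S d S as a (S b S c S) d S: below an outer arc lies a word of the same shape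
    as a whole matching. *)
Lemma arcs_Node a b c d o p :
  (p \in arcs (Node a b c d) o) =
  [|| p == (o, o.+1 + len3 a b c), p \in arcs3 a b c o.+1
    | p \in arcs d (o.+1 + len3 a b c).+1].
Proof.
rewrite /arcs3 /= !inE !mem_cat /len3.
have -> : ((o.+1 + len a).+1 + len b).+1 + len c = o.+1 + (len a + len b + len c + 2) by lia.
by rewrite -!orbA.
Qed.

(** * Noncrossing perfect arc systems on an interval *)

Definition within (lo hi : nat) (A : seq (nat * nat)) :=
  forall p : nat * nat, p \in A -> lo <= p.1 /\ p.1 < p.2 /\ p.2 < hi.

(** Two arcs are equal, side by side, or nested. The strict inequalities also forbid distinct arcs
    to share an endpoint. *)
Definition compatible (p q : nat * nat) : Prop :=
  p = q \/ p.2 < q.1 \/ q.2 < p.1 \/ (p.1 < q.1 /\ q.2 < p.2) \/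
  (q.1 < p.1 /\ p.2 < q.2).

Definition noncrossing (A : seq (nat * nat)) : Prop :=
  forall p q : nat * nat, p \in A -> q \in A -> compatible p q.

Definition covering (lo hi : nat) (A : seq (nat * nat)) : Prop :=
  forall i, lo <= i -> i < hi -> exists2 p : nat * nat, p \in A & i = p.1 \/ i = p.2.

Definition perfect (lo hi : nat) (A : seq (nat * nat)) : Prop :=
  [/\ lo <= hi, within lo hi A, noncrossing A & covering lo hi A].

Lemma perfect_cat lo mid hi A B :
  perfect lo mid A -> perfect mid hi B -> perfect lo hi (A ++ B).
Proof.
move=> [le1 wA nA cA] [le2 wB nB cB]; split; first lia.
- by move=> p; rewrite mem_cat => /orP[/wA|/wB]; lia.
- move=> p q; rewrite !mem_cat => /orP[pA|pB] /orP[qA|qB].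
  + exact: nA.
  + by move: (wA _ pA) (wB _ qB); rewrite /compatible; lia.
  + by move: (wB _ pB) (wA _ qA); rewrite /compatible; lia.
  + exact: nB.
- move=> i lei ltii; case: (ltnP i mid) => Hi.
    by have [p pA Hp] := cA i lei Hi; exists p; rewrite // mem_cat pA.
  by have [p pB Hp] := cB i Hi ltii; exists p; rewrite // mem_cat pB orbT.
Qed.

Lemma perfect_arc lo hi A : perfect lo.+1 hi A -> perfect lo hi.+1 ((lo, hi) :: A).
Proof.
move=> [le1 wA nA cA]; split; first lia.
- by move=> p; rewrite inE => /predU1P[->|/wA] /=; lia.
- move=> p q; rewrite !inE => /predU1P[->|pA] /predU1P[->|qA].
  + by left.
  + by move: (wA _ qA); rewrite /compatible /=; lia.
  + by move: (wA _ pA); rewrite /compatible /=; lia.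
  + exact: nA.
- move=> i lei ltii; have [->|[->|[H1 H2]]] : i = lo \/ i = hi \/ (lo < i /\ i < hi) by lia.
  + by exists (lo, hi); [exact: mem_head|left].
  + by exists (lo, hi); [exact: mem_head|right].
  + by have [p pA Hp] := cA i H1 H2; exists p; rewrite // inE pA orbT.
Qed.

Lemma perfect_mem lo hi A B : A =i B -> perfect lo hi A -> perfect lo hi B.
Proof.
move=> eAB [le1 wA nA cA]; split=> //.
- by move=> p; rewrite -eAB; exact: wA.
- by move=> p q; rewrite -!eAB; exact: nA.
- by move=> i h1 h2; have [p pA] := cA i h1 h2; exists p; rewrite -?eAB.
Qed.

Lemma perfect_arcs3_of x y z o :
  (forall o, perfect o (o + len x) (arcs x o)) ->
  (forall o, perfect o (o + len y) (arcs y o)) ->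
  (forall o, perfect o (o + len z) (arcs z o)) ->
  perfect o (o + len3 x y z) (arcs3 x y z o).
Proof.
move=> px py pz.
have := perfect_cat (perfect_cat (px o) (perfect_arc (py _))) (pz _).
have -> : ((o + len x).+1 + len y).+1 + len z = o + len3 x y z by rewrite /len3; lia.
by apply: perfect_mem => p; rewrite /arcs3 !(mem_cat, inE) -!orbA orbCA.
Qed.

Lemma perfect_arcs s o : perfect o (o + len s) (arcs s o).
Proof.
elim: s o => [|a IHa b IHb c IHc d IHd] o.
  by split; [lia| | |move=> i; rewrite /len /=; lia].
have := perfect_cat (perfect_arc (perfect_arcs3_of o.+1 IHa IHb IHc)) (IHd _).
have -> : (o.+1 + len3 a b c).+1 + len d = o + len (Node a b c d).
  by rewrite len_Node /len3; lia.
by apply: perfect_mem => p; rewrite arcs_Node mem_cat inE -orbA.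
Qed.

Lemma perfect_arcs3 x y z o : perfect o (o + len3 x y z) (arcs3 x y z o).
Proof. by apply: perfect_arcs3_of; exact: perfect_arcs. Qed.

(** * Recovering the trees from the set of arcs *)

Fixpoint true_positions (o : nat) (w : seq bool) : seq nat :=
  if w is b :: w' then
    (if b then [:: o] else [::]) ++ true_positions o.+1 w'
  else [::].

Lemma true_positions_cat o u v :
  true_positions o (u ++ v) = true_positions o u ++ true_positions (o + size u) v.
Proof. by elim: u o => [|b u IHu] o /=; rewrite ?addn0 // IHu addSnnS catA. Qed.

Lemma true_positions_ge o w i : i \in true_positions o w -> o <= i.
Proof.
elim: w o => // b w IHw o /=; rewrite mem_cat => /orP[|/IHw]; last lia.
by case: b; rewrite // inE => /eqP ->.
Qed.

Lemma true_positions_inj o u v : size u = size v ->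
  true_positions o u =i true_positions o v -> u = v.
Proof.
elim: u v o => [|b u IHu] [|c v] //= o [suv] E.
have out w : (o \in true_positions o.+1 w) = false.
  by apply/negP => /true_positions_ge; lia.
have Ebc : b = c.
  by have := E o; rewrite !mem_cat !out !orbF; case: b c {E} => -[]; rewrite ?inE ?eqxx.
subst c; congr (_ :: _); apply: (IHu _ o.+1) => // i.
have := E i; rewrite !mem_cat; case: b {E} => //.
by rewrite inE; case: eqP => //= ->; rewrite !out.
Qed.

Definition outer_openers (A : seq (nat * nat)) : seq nat :=
  [seq p.1 | p <- A & (p.2 - p.1) %% 4 == 3].

Lemma outer_openers_cat A B :
  outer_openers (A ++ B) = outer_openers A ++ outer_openers B.
Proof. by rewrite /outer_openers filter_cat map_cat. Qed.

(** Every subtree covers a multiple of four points. So the root's outer arc, which spans three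
    subtrees and the letters b, c, has length 3 modulo 4, and its inner arc has length 1. The
    selected openers are then exactly the letters a. *)
Lemma outer_openers_arcs s o :
  outer_openers (arcs s o) = true_positions o (code s).
Proof.
elim: s o => // a IHa b IHb c IHc d IHd o.
rewrite [LHS]/outer_openers /=.
case: eqP => [_|]; last by rewrite /len; lia.
case: eqP => [|_]; first by rewrite /len; lia.
rewrite /= -/(outer_openers _) !outer_openers_cat IHa IHb IHc IHd.
by do !rewrite true_positions_cat /= size_code.
Qed.

Lemma outer_openers_arcs3 x y z :
  outer_openers (arcs3 x y z 0) = true_positions 0 (fcode [:: x; y; z]).
Proof.
rewrite [LHS]/outer_openers /=; case: eqP => [|_]; first by rewrite /len; lia.
rewrite -/(outer_openers _) !outer_openers_cat !outer_openers_arcs /fcode /= -!catA.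
by do !rewrite true_positions_cat /= ?size_code ?cats0.
Qed.

(** The arcs give the openers of the outer arcs, these give the positions of [true] in a word of
    known length, and the word determines the forest. *)
Lemma arcs3_inj x y z x' y' z' : len3 x y z = len3 x' y' z' ->
  arcs3 x y z 0 =i arcs3 x' y' z' 0 -> [:: x; y; z] = [:: x'; y'; z'].
Proof.
move=> El Ea; apply: fcode_inj => //; apply: (@true_positions_inj 0).
  by move: El; rewrite /fcode /= !size_cat !size_code /len3 /=; lia.
move=> i; rewrite -!outer_openers_arcs3.
by apply/mapP/mapP => -[p]; rewrite mem_filter => /andP[H1 H2] ->; exists p;
  rewrite // mem_filter H1 ?Ea // -Ea.
Qed.

(** * From arcs to matchings *)

Definition edge (n : nat) (p : nat * nat) : {set 'I_n.+1} := [set pt n p.1; pt n p.2].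

Definition arc_matching (n : nat) (A : seq (nat * nat)) : {set {set 'I_n.+1}} :=
  [set:: map (edge n) A].

Lemma val_pt n j : j <= n -> pt n j = j :> nat.
Proof. by move=> jn; rewrite /pt modn_small // inordK. Qed.

Lemma pt_ord n (j : 'I_n.+1) : pt n j = j.
Proof. by apply: val_inj; rewrite /= val_pt // -ltnS. Qed.

Lemma eq_pt n i j : i <= n -> j <= n -> (pt n i == pt n j) = (i == j).
Proof. by move=> hi hj; rewrite -val_eqE /= !val_pt. Qed.

Lemma pt_mod n j : pt n (j %% n.+1) = pt n j.
Proof. by rewrite /pt modn_mod. Qed.

Lemma ptDn n j : pt n (j + n.+1) = pt n j.
Proof. by rewrite /pt modnDr. Qed.

Lemma edge_inj n p q : p.1 < p.2 <= n -> q.1 < q.2 <= n ->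
  edge n p = edge n q -> p = q.
Proof.
case: p q => [a b] [c d] /= h1 h2 /setP E.
have mem x : x <= n -> ((x == a) || (x == b)) = ((x == c) || (x == d)).
  by move=> xn; have := E (pt n x); rewrite !inE /= !eq_pt; lia.
have [] : a <= n /\ b <= n /\ c <= n /\ d <= n by lia.
move=> /mem Ea [/mem Eb] [/mem Ec] /mem Ed.
congr pair; lia.
Qed.

Lemma mem_arc_matching n A (e : {set 'I_n.+1}) :
  reflect (exists2 p : nat * nat, p \in A & e = edge n p) (e \in arc_matching n A).
Proof. by rewrite inE; exact: mapP. Qed.

Lemma eq_arc_matching n A B : A =i B -> arc_matching n A = arc_matching n B.
Proof. by move=> E; apply/setP => e; rewrite !inE; exact: eq_mem_map. Qed.

Lemma arc_matching_inj n A B : within 0 n.+1 A -> within 0 n.+1 B ->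
  arc_matching n A = arc_matching n B -> A =i B.
Proof.
have sub C D : within 0 n.+1 C -> within 0 n.+1 D ->
    arc_matching n C = arc_matching n D -> {subset C <= D}.
  move=> wC wD E p pC.
  have : edge n p \in arc_matching n D by rewrite -E; apply/mem_arc_matching; exists p.
  case/mem_arc_matching => q qD /edge_inj -> //; [move: (wC _ pC)|move: (wD _ qD)]; lia.
by move=> wA wB E p; apply/idP/idP; apply: sub.
Qed.

Lemma perfect_is_matching n A : perfect 0 n.+1 A -> is_matching (arc_matching n A).
Proof.
move=> [_ wA nA cA].
have wb (p : nat * nat) : p \in A -> p.1 < p.2 <= n by move=> /wA; lia.
apply/and3P; split.
- apply/and3P; split.
  + apply/eqP/setP => i; rewrite inE; apply/bigcupP.
    have [p pA Hp] := cA i (leq0n _) (ltn_ord i).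
    exists (edge n p); first by apply/mem_arc_matching; exists p.
    by move: (wb _ pA) (ltn_ord i) => w_p lt_i; rewrite !inE -(pt_ord i) !eq_pt; lia.
  + apply/trivIsetP => _ _ /mem_arc_matching[p pA ->] /mem_arc_matching[q qA ->] npq.
    have nepq : p <> q by move=> E; rewrite E eqxx in npq.
    move: (nA _ _ pA qA) (wb _ pA) (wb _ qA); case=> [//|] C wp wq.
    rewrite -setI_eq0; apply/eqP/setP => i; move: (ltn_ord i) => lt_i.
    by rewrite !inE -(pt_ord i) !eq_pt; lia.
  + apply/negP => /mem_arc_matching[p pA] /setP /(_ (pt n p.1)).
    by rewrite !inE eqxx.
- apply/forall_inP => e /mem_arc_matching[p pA ->].
  by rewrite cards2 eq_pt; move: (wb _ pA); lia.
- apply/forall_inP => _ /mem_arc_matching[p pA ->].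
  apply/forall_inP => _ /mem_arc_matching[q qA ->].
  apply/negP => /existsP[a] /existsP[b] /existsP[c] /existsP[d].
  case/and5P => /eqP e1 /eqP e2 ac cb bd.
  have lt_b := ltn_ord b; have lt_d := ltn_ord d.
  have E1 : p = (a : nat, b : nat).
    apply: (@edge_inj n); first exact: wb; first by rewrite /=; lia.
    by rewrite e1 /edge /= !pt_ord.
  have E2 : q = (c : nat, d : nat).
    apply: (@edge_inj n); first exact: wb; first by rewrite /=; lia.
    by rewrite e2 /edge /= !pt_ord.
  by move: (nA _ _ pA qA); rewrite E1 E2 /compatible /= => -[[]|]; lia.
Qed.

(** * Rotation *)

Definition rot_pt n (i : nat) (j : 'I_n.+1) : 'I_n.+1 := pt n (i + j).

Definition rot_matching n (i : nat) (M : {set {set 'I_n.+1}}) : {set {set 'I_n.+1}} :=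
  [set rot_pt i @: (e : {set _}) | e in M].

Lemma rot_pt_pt n i j : rot_pt i (pt n j) = pt n (i + j).
Proof.
rewrite /rot_pt -(pt_mod _ j) -pt_mod val_pt; last by rewrite -ltnS ltn_mod.
by rewrite modnDmr pt_mod.
Qed.

Lemma rot_pt_inj n i : injective (@rot_pt n i).
Proof.
move=> j k E.
(* The inverse rotation completes a full turn; [i] may exceed the number of points, so it is first
   reduced. *)
have H l : @rot_pt n (n.+1 - i %% n.+1) (rot_pt i l) = l.
  rewrite -[rot_pt i l]/(pt n (i + l)) rot_pt_pt -[RHS]pt_ord -[LHS]pt_mod.
  have -> : n.+1 - i %% n.+1 + (i + l) = (i %/ n.+1).+1 * n.+1 + l.
    by have := ltn_pmod i (ltn0Sn n); have := divn_eq i n.+1; lia.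
  by rewrite modnMDl pt_mod.
by rewrite -(H j) E H.
Qed.

Lemma rot_edge n i a b : rot_pt i @: edge n (a, b) = edge n (i + a, i + b).
Proof. by rewrite /edge /= imsetU1 imset_set1 !rot_pt_pt. Qed.

Definition shift (m : nat) (p : nat * nat) := (m + p.1, m + p.2).

Lemma rot_arc_matching n i A :
  rot_matching i (arc_matching n A) = arc_matching n (map (shift i) A).
Proof.
apply/setP => e; apply/imsetP/mem_arc_matching.
  case=> _ /mem_arc_matching[[a b] pA ->] ->; exists (shift i (a, b)).
    by apply: map_f.
  by rewrite rot_edge.
case=> _ /mapP[[a b] pA ->] ->; exists (edge n (a, b)); last by rewrite rot_edge.
by apply/mem_arc_matching; exists (a, b).
Qed.

Lemma rot_matchingD n i j (M : {set {set 'I_n.+1}}) :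
  rot_matching i (rot_matching j M) = rot_matching (i + j) M.
Proof.
rewrite /rot_matching -imset_comp; apply: eq_imset => e /=.
rewrite -imset_comp; apply: eq_imset => k /=.
by rewrite -[rot_pt j k]/(pt n (j + k)) rot_pt_pt addnA.
Qed.

Lemma rot_matching_mod n i (M : {set {set 'I_n.+1}}) :
  rot_matching (i %% n.+1) M = rot_matching i M.
Proof.
apply: eq_imset => e; apply: eq_imset => k.
by rewrite /rot_pt -pt_mod modnDml pt_mod.
Qed.

Lemma rot_matching0 n (M : {set {set 'I_n.+1}}) : rot_matching 0 M = M.
Proof.
rewrite /rot_matching -[RHS]imset_id; apply: eq_imset => e /=.
by rewrite -[RHS]imset_id; apply: eq_imset => k; rewrite /rot_pt pt_ord.
Qed.

(** * Rotation of words *)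

Lemma arcs_shift s m o : arcs s (m + o) = map (shift m) (arcs s o).
Proof.
elim: s o => // a IHa b IHb c IHc d IHd o.
by rewrite /= !map_cat -IHa -IHb -IHc -IHd /shift /= -!addnS !addnA.
Qed.

Lemma arcs3_shift x y z m o : arcs3 x y z (m + o) = map (shift m) (arcs3 x y z o).
Proof. by rewrite /arcs3 /= !map_cat -!arcs_shift /shift /= -!addnS !addnA. Qed.

Lemma mem_arcs3 x y z o p : (p \in arcs3 x y z o) =
  [|| p == (o + len x, (o + len x).+1 + len y), p \in arcs x o,
      p \in arcs y (o + len x).+1 | p \in arcs z ((o + len x).+1 + len y).+1].
Proof. by rewrite /arcs3 in_cons !mem_cat. Qed.

(* Concatenation of the words derived from S: [t] is hung on the last S of [s]. *)
Fixpoint graft (s t : qtree) : qtree :=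
  if s is Node a b c d then Node a b c (graft d t) else t.

Lemma nodes_graft s t : nodes (graft s t) = nodes s + nodes t.
Proof. by elim: s => //= a _ b _ c _ d ->; lia. Qed.

Lemma graft_leaf s : graft s Leaf = s.
Proof. by elim: s => //= a _ b _ c _ d ->. Qed.

Lemma arcs_graft s t o p :
  (p \in arcs (graft s t) o) = (p \in arcs s o) || (p \in arcs t (o + len s)).
Proof.
elim: s o => [|a _ b _ c _ d IHd] o; first by rewrite addn0.
rewrite [graft _ _]/= !arcs_Node IHd -!orbA; do !bool_congr.
by congr (_ \in arcs t _); rewrite len_Node /len3; lia.
Qed.

Definition triple : Type := qtree * qtree * qtree.

Definition tarcs (t : triple) : seq (nat * nat) := arcs3 t.1.1 t.1.2 t.2 0.
Definition tlen (t : triple) : nat := len3 t.1.1 t.1.2 t.2.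

(* Moves the first letter to the end. Its arc is then opened by its other end, so the letters of
   that arc are exchanged: a with d, or b with c. *)
Definition rotate (t : triple) : triple :=
  let: (x, y, z) := t in
  if x is Node a b c d then (a, b, graft c (Node d y z Leaf)) else (y, z, Leaf).

Lemma tlen_rotate t : tlen (rotate t) = tlen t.
Proof.
by case: t => [[[|a b c d] y] z]; rewrite /tlen /len3 /len /= ?nodes_graft /=; lia.
Qed.

(** [rotate] moves all letters but the first one place down, and rotating the points by 1 undoes
    this. The moved letter lands on position [n.+1], which is point 0, so only its arc changes form,
    with its two ends exchanged. *)
Lemma rotate_arcs n t : tlen t = n.+1 ->
  rot_matching 1 (arc_matching n (tarcs (rotate t))) = arc_matching n (tarcs t).
Proof.
move=> tn; rewrite rot_arc_matching /tarcs -arcs3_shift addn0.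
case: t tn => [[[|a b c d] y] z]; rewrite /tlen /=.
  rewrite /len3 /= => tn; apply/setP => e; rewrite /arcs3 /= !cats0 !inE.
  congr (_ || _); rewrite (_ : (1 + len y).+1 + len z = 0 + n.+1); last first.
    by rewrite -tn /len /=; lia.
  by rewrite /edge /= ptDn setUC.
(* [o3] is the position of the letter d closing the first outer arc: that arc is [(0, o3)] before
   and [(o3, n.+1)] after the rotation. *)
move=> tn; set o3 := 1 + len3 a b c.
have -> : arc_matching n (arcs3 a b (graft c (Node d y z Leaf)) 1) =
    arc_matching n ((o3, n.+1) :: arcs3 a b c 1 ++ arcs3 d y z o3.+1).
  apply: eq_arc_matching => p; rewrite mem_arcs3 in_cons mem_cat !mem_arcs3 arcs_graft.
  rewrite (_ : _ + len c = o3); last by rewrite /o3 /len3; lia.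
  rewrite arcs_Node (mem_arcs3 d) (_ : o3.+1 + len3 d y z = n.+1); last first.
    by rewrite -tn /o3 /len3 len_Node; lia.
  by rewrite in_nil orbF -!orbA; do 4![rewrite [RHS]orbCA; congr (_ || _)].
have -> : arc_matching n (arcs3 (Node a b c d) y z 0) =
    arc_matching n ((0, o3) :: arcs3 a b c 1 ++ arcs3 d y z o3.+1).
  apply: eq_arc_matching => p.
  rewrite mem_arcs3 [RHS]in_cons [in RHS]mem_cat (mem_arcs3 d).
  rewrite (_ : 0 + len (Node a b c d) = o3.+1 + len d); last by rewrite len_Node /o3 /len3; lia.
  by rewrite arcs_Node -!orbA orbCA; congr (_ || _); rewrite orbCA; congr (_ || _); rewrite orbCA.
apply/setP => e; rewrite !inE; congr (_ || _).
by rewrite /edge /= -(ptDn n 0) add0n setUC.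
Qed.

Definition tmatching n (t : triple) : {set {set 'I_n.+1}} := arc_matching n (tarcs t).

Lemma tlen_iter_rotate j t : tlen (iter j rotate t) = tlen t.
Proof. by elim: j => //= j IHj; rewrite tlen_rotate. Qed.

Lemma rot_iter_rotate n j t : tlen t = n.+1 ->
  rot_matching j (tmatching n (iter j rotate t)) = tmatching n t.
Proof.
move=> tn; elim: j => [|j IHj]; first by rewrite rot_matching0.
by rewrite -{1}[j.+1]addn1 -rot_matchingD rotate_arcs ?tlen_iter_rotate.
Qed.

(** Moving [n.+1 - i %% n.+1] letters is undone by as many rotations of the points; the further
    rotation by [i] completes a full turn. *)
Lemma rot_tmatching n i t : tlen t = n.+1 ->
  exists2 t', tlen t' = n.+1 & rot_matching i (tmatching n t) = tmatching n t'.
Proof.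
move=> tn; exists (iter (n.+1 - i %% n.+1) rotate t); first by rewrite tlen_iter_rotate.
rewrite -[in LHS](rot_iter_rotate (n.+1 - i %% n.+1) tn) -rot_matching_mod rot_matchingD.
by rewrite subnKC ?(ltnW (ltn_pmod _ _)) // -rot_matching_mod modnn rot_matching0.
Qed.

(** The three leading leaves say that the rotated word starts with a b c d, a block on the points 0,
    1, 2, 3. *)
Definition rotates_to_block (t : triple) : Prop :=
  exists j x y z, iter j rotate t = (Node Leaf Leaf Leaf x, y, z).

Lemma rotates_to_block_rotate t : rotates_to_block (rotate t) -> rotates_to_block t.
Proof. by move=> [j [x [y [z E]]]]; exists j.+1, x, y, z; rewrite iterSr. Qed.

(** Rotation opens the first tree and exposes its children one after another, so one descends into
    the first child among [a], [b], [c] that is not a leaf. If all three are leaves, the block is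
    already in front. The grafted [r] is needed because [rotate] hangs the rest of the word on
    [c]. *)
Lemma rotates_to_block_graft s : s <> Leaf ->
  forall r y z, rotates_to_block (graft s r, y, z).
Proof.
elim: s => // a IHa b IHb c IHc d _ _ r y z.
have [a0|/eqP a0] := eqVneq a Leaf; last first.
  by apply: rotates_to_block_rotate; rewrite /= -{1}(graft_leaf a); exact: IHa.
subst a; have [b0|/eqP b0] := eqVneq b Leaf; last first.
  by do 2!apply: rotates_to_block_rotate; rewrite /= -{1}(graft_leaf b); exact: IHb.
subst b; have [c0|/eqP c0] := eqVneq c Leaf; last first.
  by do 3!apply: rotates_to_block_rotate; exact: IHc.
by subst c; exists 0, (graft d r), y, z.
Qed.

Lemma tlen_rotates_to_block t : 2 < tlen t -> rotates_to_block t.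
Proof.
case: t => [[x y] z] t2.
have [x0|/eqP x0] := eqVneq x Leaf; last first.
  by rewrite -(graft_leaf x); exact: rotates_to_block_graft.
subst x; apply: rotates_to_block_rotate => /=.
have [y0|/eqP y0] := eqVneq y Leaf; last first.
  by rewrite -(graft_leaf y); exact: rotates_to_block_graft.
subst y; apply: rotates_to_block_rotate => /=.
have [z0|/eqP z0] := eqVneq z Leaf; last first.
  by rewrite -(graft_leaf z); exact: rotates_to_block_graft.
(* Three leaves would give length 2, against [t2]. *)
by subst z.
Qed.

(** * I-matchings *)

Section InsertBlock.

Variables (n : nat) (i : 'I_n.+1.+4).

(** The inverse of [remove_block i] on matchings with a block at [i]. *)
Definition insert_block (N : {set {set 'I_n.+1}}) : {set {set 'I_n.+1.+4}} :=
  block_edge1 i |: (block_edge2 i |: [set relabel i @: (e : {set _}) | e in N]).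

(** A shift by 4 without wrap-around followed by a rotation: facts on [relabel] thus reduce to the
    case of a block on 0, 1, 2, 3. *)
Lemma relabelE (j : 'I_n.+1) : relabel i j = rot_pt i (pt n.+4 (4 + j)).
Proof. by rewrite rot_pt_pt addnA. Qed.

Lemma relabel_inj : injective (@relabel n.+1 i).
Proof.
move=> j k; rewrite !relabelE => /rot_pt_inj/eqP.
have := ltn_ord j; have := ltn_ord k => ltk ltj.
by rewrite eq_pt; try lia; rewrite eqn_add2l => /eqP/val_inj.
Qed.

Lemma relabel_neq c (j : 'I_n.+1) : c < 4 -> relabel i j != pt n.+4 (i + c).
Proof.
move=> c4; have ltj := ltn_ord j.
by rewrite relabelE -(rot_pt_pt _ i) (inj_eq (@rot_pt_inj _ _)) eq_pt; lia.
Qed.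

Lemma relabel_surj (k : 'I_n.+1.+4) :
  (k \in block_edge1 i) || (k \in block_edge2 i) \/ exists j, k = relabel i j.
Proof.
have [g _ gK] := injF_bij (@rot_pt_inj n.+4 i).
rewrite -(gK k) -(pt_ord (g k)); set l := nat_of_ord (g k); have ltl : l < n.+1.+4 := ltn_ord (g k).
case: (ltnP l 4) => [l4|l4].
  left; rewrite rot_pt_pt !inE.
  case: l l4 {ltl} => [|[|[|[|l]]]] // _; by rewrite ?addn0 eqxx ?orbT.
right; have lt_j : l - 4 < n.+1 by lia.
by exists (Ordinal lt_j); rewrite relabelE /= subnKC.
Qed.

Lemma relabel_notin_block j :
  (relabel i j \notin block_edge1 i) && (relabel i j \notin block_edge2 i).
Proof.
have H c : c < 4 -> (relabel i j == pt n.+4 (i + c)) = false.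
  by move=> c4; apply/negbTE; exact: relabel_neq.
by have := H 0 isT; rewrite addn0 !inE => ->; rewrite !H.
Qed.

Lemma remove_insert_block N : remove_block i (insert_block N) = N.
Proof.
have preK (e : {set 'I_n.+1}) : [set j | relabel i j \in relabel i @: e] = e.
  by apply/setP => j; rewrite inE mem_imset //; exact: relabel_inj.
apply/setP => e; apply/imsetP/idP.
  case=> f; rewrite !inE => /and3P[/negbTE -> /negbTE ->] /= /imsetP[g gN ->] ->.
  by rewrite preK.
move=> eN; exists (relabel i @: e); last by rewrite preK.
rewrite !inE imset_f ?orbT // andbT.
have out k (B : {set 'I_n.+1.+4}) :
    k \in B -> (forall j, relabel i j \notin B) -> relabel i @: e != B.
  move=> kB nB; apply/eqP => E; move: kB; rewrite -E => /imsetP[j je Ek].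
  by have := nB j; rewrite -E imset_f.
have out1 : relabel i @: e != block_edge1 i.
  by apply: (out (pt _ i)) => [|j]; [rewrite !inE eqxx|case/andP: (relabel_notin_block j)].
have out2 : relabel i @: e != block_edge2 i.
  by apply: (out (pt _ (i + 1))) => [|j]; [rewrite !inE eqxx|case/andP: (relabel_notin_block j)].
by rewrite out1 out2.
Qed.

Lemma is_block_insert N : is_block i (insert_block N).
Proof. by rewrite /is_block !inE !eqxx orbT. Qed.

(** The other edges of [M] are disjoint from the two block edges, so they lie in the range of
    [relabel] and are recovered from their preimages. *)
Lemma insert_remove_block M : is_matching M -> is_block i M ->
  insert_block (remove_block i M) = M.
Proof.
move=> /and3P[/and3P[_ /trivIsetP tM _] _ _] /andP[b1M b2M].
have image_preimage e : e \in M :\ block_edge1 i :\ block_edge2 i ->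
    relabel i @: [set j | relabel i j \in e] = e.
  rewrite !inE => /and3P[e2 e1 eM]; apply/setP => k; apply/imsetP/idP.
    by case=> j; rewrite inE => + ->.
  move=> ke; case: (relabel_surj k) => [|[j Ek]]; last by exists j; rewrite // inE -Ek.
  have /disjointFr /(_ ke) -> := tM _ _ eM b1M e1.
  by have /disjointFr /(_ ke) -> := tM _ _ eM b2M e2.
apply/setP => e; rewrite !inE; apply/or3P/idP.
- case=> [/eqP -> //|/eqP -> //|/imsetP[_ /imsetP[f fM ->] ->]].
  by rewrite image_preimage //; move: fM; rewrite !inE => /and3P[].
- move=> eM; have [e1|e1] := boolP (e == _); first by constructor 1.
  have [e2|e2] := boolP (e == block_edge2 i); first by constructor 2.
  have eM' : e \in M :\ block_edge1 i :\ block_edge2 i by rewrite !inE e1 e2.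
  constructor 3; rewrite -[e]image_preimage //.
  by apply: imset_f; apply/imsetP; exists e.
Qed.

(** Putting a b c d in front of the word makes [x] the last child of a new root; the place [i] of
    the block is accounted for by a rotation. *)
Lemma insert_block_tmatching x y z : tlen (x, y, z) = n.+1 ->
  insert_block (tmatching n (x, y, z)) =
  rot_matching i (tmatching n.+4 (Node Leaf Leaf Leaf x, y, z)).
Proof.
move=> tn.
have wb (p : nat * nat) : p \in tarcs (x, y, z) -> p.1 < p.2 <= n.
  have [_ w _ _] := perfect_arcs3 x y z 0.
  by move=> /w; move: tn; rewrite /tlen /=; lia.
have -> : tmatching n.+4 (Node Leaf Leaf Leaf x, y, z) =
    arc_matching n.+4 [:: (0, 3), (1, 2) & arcs3 x y z (4 + 0)].
  apply: eq_arc_matching => p.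
  rewrite -[tarcs _]/(arcs3 (Node Leaf Leaf Leaf x) y z 0) mem_arcs3 arcs_Node !mem_arcs3.
  rewrite [in RHS]in_cons [in RHS]in_cons mem_arcs3 -!orbA.
  rewrite (_ : 0 + len (Node _ _ _ _) = 4 + 0 + len x); last by rewrite len_Node /len /=; lia.
  by rewrite orbCA; congr (_ || _); rewrite orbCA.
rewrite arcs3_shift -/(tarcs (x, y, z)).
rewrite rot_arc_matching 2!map_cons; apply/setP => e; rewrite [in LHS]inE in_set1.
rewrite [in LHS]inE in_set1 [in RHS]inE 2!map_cons 2!in_cons.
have -> : block_edge1 i = edge n.+4 (shift i (0, 3)) by rewrite /edge /= addn0.
congr [|| _, _ | _]; rewrite -map_comp; apply/imsetP/mapP.
  case=> _ /mem_arc_matching[p pA ->] ->; exists (shift 4 p); first exact: map_f.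
  rewrite /edge imsetU1 imset_set1 /relabel /=.
  by rewrite !val_pt ?addnA //; move: (wb _ pA); lia.
case=> _ /mapP[p pA ->] ->; exists (edge n p); first by apply/mem_arc_matching; exists p.
rewrite /edge imsetU1 imset_set1 /relabel /=.
by rewrite !val_pt ?addnA //; move: (wb _ pA); lia.
Qed.

End InsertBlock.

(* The points are [0, ..., last_point m]; the recursion makes [(last_point m.+1).+1] convertible
   to [(last_point m).+1.+4], as [isI] and [remove_block] require. *)
Fixpoint last_point (m : nat) : nat := if m is m'.+1 then (last_point m').+4 else 1.

Lemma last_pointE m : last_point m = (4 * m).+1.
Proof. by elim: m => //= m ->; lia. Qed.

Definition tnodes (t : triple) : nat := nodes t.1.1 + nodes t.1.2 + nodes t.2.

Lemma tlen_last_point m t : (tlen t == (last_point m).+1) = (tnodes t == m).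
Proof. by rewrite /tlen /len3 /len /tnodes last_pointE; lia. Qed.

Lemma tmatching_is_matching n t : tlen t = n.+1 -> is_matching (tmatching n t).
Proof.
by move=> tn; apply: perfect_is_matching; rewrite -tn; exact: perfect_arcs3.
Qed.

(** The parity test always succeeds: 4m + 6 points carry 2m + 3 edges. *)
Lemma isIE m (M : {set {set 'I_(last_point m).+1.+4}}) :
  isI M = is_matching M && [exists i, is_block i M && isI (remove_block i M)].
Proof.
have odd_size : odd ((last_point m).+1.+4)./2.
  by rewrite last_pointE (_ : (4 * m).+1.+1.+4 = m.*2.+3.*2); [rewrite doubleK /= odd_double|lia].
rewrite -[isI M]/([&& _, is_matching M & [exists i, is_block i M && isI (remove_block i M)]]).
by rewrite odd_size.
Qed.

Lemma is_matching2 (M : {set {set 'I_2}}) :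
  is_matching M -> M = tmatching 1 (Leaf, Leaf, Leaf).
Proof.
have full (e : {set 'I_2}) : #|e| = 2 -> e = setT.
  by move=> e2; apply/eqP; rewrite eqEcard subsetT cardsT card_ord e2.
move=> /and3P[/and3P[/eqP cM _ _] /forall_inP c2 _].
have e01 : edge 1 (0, 1) = setT by apply: full; rewrite cards2 eq_pt.
have -> : tmatching 1 (Leaf, Leaf, Leaf) = [set setT].
  by apply/setP => e; rewrite !inE -e01.
have [e eM] : exists e, e \in M.
  have : (ord0 : 'I_2) \in cover M by rewrite cM inE.
  by case/bigcupP => e eM _; exists e.
apply/setP => f; rewrite inE; apply/idP/eqP => [fM|->].
  by apply: full; apply/eqP; exact: c2.
by rewrite -(full e) //; apply/eqP; exact: c2.
Qed.

(** Blocks occur anywhere, whereas trees describe only a block in front; rotation bridges the two.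
    Forwards, the reinserted block gives a rotated word, which is again a word of the class.
    Backwards, the word is rotated until a block comes first. *)
Lemma isI_tmatching m (M : {set {set 'I_(last_point m).+1}}) :
  isI M <-> exists2 t, tnodes t = m & M = tmatching (last_point m) t.
Proof.
elim: m M => [|m IHm] M.
  split=> [/is_matching2 ->|[t t0 ->]]; first by exists (Leaf, Leaf, Leaf).
  by apply: tmatching_is_matching; apply/eqP; rewrite (tlen_last_point 0) t0.
rewrite isIE; split=> [/andP[mM /existsP[i /andP[bM /IHm[[[x y] z]]]]]|[t tm ->]].
- move=> /eqP; rewrite -tlen_last_point => /eqP tl E.
  rewrite -(insert_remove_block mM bM) E insert_block_tmatching //.
  have [|t tl' ->] := @rot_tmatching (last_point m).+4 i (Node Leaf Leaf Leaf x, y, z).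
    by move: tl; rewrite /tlen /len3 len_Node /=; rewrite /len /=; lia.
  by exists t => //; apply/eqP; rewrite -(tlen_last_point m.+1) tl'.
- have tl : tlen t = (last_point m).+1.+4 by apply/eqP; rewrite (tlen_last_point m.+1) tm.
  rewrite tmatching_is_matching //=.
  have [|j [x [y [z E]]]] := @tlen_rotates_to_block t; first by rewrite tl.
  have tl' : tlen (x, y, z) = (last_point m).+1.
    have := tlen_iter_rotate j t; rewrite E tl /tlen /len3 len_Node /=.
    by rewrite /len /=; lia.
  (* After [j] letters have been moved, the block in front sits at index [j], modulo the number of
     points, in the original matching. *)
  have lt_i : j %% (last_point m).+1.+4 < (last_point m).+1.+4 by rewrite ltn_mod.
  apply/existsP; exists (Ordinal lt_i).
  rewrite -(rot_iter_rotate j tl) E -rot_matching_mod.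
  rewrite -(insert_block_tmatching (Ordinal lt_i)) // is_block_insert remove_insert_block.
  by apply/IHm; exists (x, y, z) => //; apply/eqP; rewrite -tlen_last_point tl'.
Qed.

(** The default [set0] is never met on [forests m 3], whose members have exactly three trees. *)
Definition forest_matching n (f : seq qtree) : {set {set 'I_n.+1}} :=
  if f is [:: x; y; z] then tmatching n (x, y, z) else set0.

Lemma card_isI m : #|[set M : {set {set 'I_(last_point m).+1}} | isI M]| = size (forests m 3).
Proof.
have -> : [set M | isI M] = [set:: map (forest_matching (last_point m)) (forests m 3)].
  apply/setP => M; rewrite !inE; apply/idP/mapP.
    move=> /isI_tmatching[[[x y] z] tm ->]; exists [:: x; y; z] => //.
    by rewrite mem_forests /= -tm /forest_nodes /tnodes /= addn0 addnA.
  case=> f; rewrite mem_forests; case: f => [|x [|y [|z []]]] //= /eqP tm ->.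
  by apply/isI_tmatching; exists (x, y, z); rewrite // -tm /forest_nodes /tnodes /= addn0 addnA.
rewrite cardsE (card_uniqP _) ?size_map // map_inj_in_uniq ?forests_uniq //.
have tl x y z : forest_nodes [:: x; y; z] = m -> tlen (x, y, z) = (last_point m).+1.
  by move=> fm; apply/eqP; rewrite tlen_last_point -fm /forest_nodes /tnodes /= addn0 addnA.
move=> f g; rewrite !mem_forests.
case: f g => [|x [|y [|z []]]] // [|x' [|y' [|z' []]]] //= /eqP/tl tf /eqP/tl tg.
have [_ wf _ _] := perfect_arcs3 x y z 0; have [_ wg _ _] := perfect_arcs3 x' y' z' 0.
have El : len3 x y z = len3 x' y' z' by rewrite -[LHS]/(tlen (x, y, z)) tf -tg.
move=> /arc_matching_inj E; apply: arcs3_inj => //.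
by apply: E; rewrite -?tf // tf -tg.
Qed.

(* For odd k and l = ceil(k/2), l * #(I-matchings of X_{2k} of size k) = C(4l-2, l-1). *)
Theorem mainTheorem12 (k : nat) (hk : odd k) :
  (k.+1)./2 * #|[set M : {set {set 'I_(k.*2)}} | isI M]|
  = 'C(4 * (k.+1)./2 - 2, (k.+1)./2 - 1).
Proof.
have -> : k = (k./2).*2.+1 by rewrite -[LHS]odd_double_half hk.
move: (k./2) => m.
(* With k = 2m + 1 there are 4m + 2 points and l = m + 1, so the claimed binomial is 'C(4m + 2,
   m). *)
have -> : (m.*2.+1).*2 = (last_point m).+1 by rewrite last_pointE; lia.
rewrite card_isI /= doubleK size_forests3 subn1 /=.
by congr binomial; lia.
Qed.
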